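(* Let $n\ge 2$, $m\ge2$ and $\mathcal{F}=\mathbb{Q}(x_{j,i}:0\le j\le m,\ i\in\mathbb{Z}/n\mathbb{Z})$. The $m-1$ simple cluster $R$-matrices $R_{M_1},\dots,R_{M_{m-1}}:\mathcal{F}\to\mathcal{F}$ satisfy $R_{M_i}R_{M_{i+1}}R_{M_i}=R_{M_{i+1}}R_{M_i}R_{M_{i+1}}$ for $1\le i\le m-2$ and $R_{M_i}^2=\mathrm{id}$ for $1\le i\le m-1$. Furthermore $R_{M_i}R_{M_j}=R_{M_j}R_{M_i}$ whenever $|i-j|>1$. Thus the $R_{M_i}$ generate an action of the symmetric group $\mathfrak{S}_m$ on $\mathcal{F}$.
   Context: Second indices are taken in $\mathbb{Z}/n\mathbb{Z}$. For $1\le j\le m-1$, $R_{M_j}:\mathcal{F}\to\mathcal{F}$ is the rational transformation (field homomorphism) fixing every $x_{j',i}$ with $j'\ne j$ and with $$R_{M_j}(x_{j,i})=\frac{\sum_{l\in\mathbb{Z}/n\mathbb{Z}}x_{j-1,l+1}\Big(\prod_{h\in(\mathbb{Z}/n\mathbb{Z})\setminus\{l,l+1\}}x_{j,h}\Big)x_{j+1,l}}{\prod_{h\ne i}x_{j,h}}.$$ Products of the $R_{M_i}$ denote composition. *)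

(* Defs.v *)
From HB Require Import structures.
From mathcomp Require Import all_boot all_order all_algebra all_fingroup.
From mathcomp Require Import generic_quotient.
From mathcomp.multinomials Require Import mpoly.
From mathcomp Require Import ring.

Set Implicit Arguments.
Unset Strict Implicit.
Unset Printing Implicit Defensive.

Import GRing.Theory.
Local Open Scope ring_scope.

Section HasVal.
Variables (A : comNzRingType) (F K : fieldType).
Variables (iota : {rmorphism A -> F}) (w : {rmorphism A -> K}).
Hypothesis iota_inj : injective iota.

(* g is the value of f "at w", computed from some representation of f as a
   fraction whose denominator w does not kill. *)
Definition hasval (f : F) (g : K) : Prop :=
  exists p q : A, [/\ w q != 0, f * iota q = iota p & g * w q = w p].

Lemma hasval0_eq0 g : hasval 0 g -> g = 0.
Proof.
case=> p [q] [q0]; rewrite mul0r -(rmorph0 iota) => /iota_inj <- E.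
by apply: (mulIf q0); rewrite E rmorph0 mul0r.
Qed.

Lemma hasval_embed p : hasval (iota p) (w p).
Proof. by exists p, 1; rewrite !rmorph1 !mulr1 oner_neq0. Qed.

Lemma hasval1 : hasval 1 1.
Proof. by rewrite -(rmorph1 iota) -(rmorph1 w); apply: hasval_embed. Qed.

Lemma hasval0 : hasval 0 0.
Proof. by rewrite -(rmorph0 iota) -(rmorph0 w); apply: hasval_embed. Qed.

Lemma hasvalD f1 f2 g1 g2 :
  hasval f1 g1 -> hasval f2 g2 -> hasval (f1 + f2) (g1 + g2).
Proof.
move=> [p1 [q1 [n1 e1 v1]]] [p2 [q2 [n2 e2 v2]]].
exists (p1 * q2 + p2 * q1), (q1 * q2).
rewrite !(rmorphD, rmorphM) mulf_neq0 // -e1 -e2 -v1 -v2; split=> //; ring.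
Qed.

Lemma hasvalM f1 f2 g1 g2 :
  hasval f1 g1 -> hasval f2 g2 -> hasval (f1 * f2) (g1 * g2).
Proof.
move=> [p1 [q1 [n1 e1 v1]]] [p2 [q2 [n2 e2 v2]]].
exists (p1 * p2), (q1 * q2).
rewrite !rmorphM mulf_neq0 // -e1 -e2 -v1 -v2; split=> //; ring.
Qed.

Lemma hasvalV f g : g != 0 -> hasval f g -> hasval f^-1 g^-1.
Proof.
move=> g0 [p [q [n e v]]].
have f0 : f != 0.
  apply: contra_neq g0 => f0; apply: hasval0_eq0; rewrite -f0.
  by exists p, q.
by exists q, p; rewrite -v -e mulf_neq0 // !mulKf.
Qed.

Lemma hasval_prod (I : Type) (r : seq I) (P : pred I) f g :
  (forall i, P i -> hasval (f i) (g i)) ->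
  hasval (\prod_(i <- r | P i) f i) (\prod_(i <- r | P i) g i).
Proof.
move=> H; apply: big_ind2 => //; first exact: hasval1.
by move=> *; apply: hasvalM.
Qed.

Lemma hasval_sum (I : Type) (r : seq I) (P : pred I) f g :
  (forall i, P i -> hasval (f i) (g i)) ->
  hasval (\sum_(i <- r | P i) f i) (\sum_(i <- r | P i) g i).
Proof.
move=> H; apply: big_ind2 => //; first exact: hasval0.
by move=> *; apply: hasvalD.
Qed.

Lemma hasvalXn f g k : hasval f g -> hasval (f ^+ k) (g ^+ k).
Proof.
move=> H; elim: k => [|k IH]; first by rewrite !expr0; apply: hasval1.
by rewrite !exprS; apply: hasvalM.
Qed.

End HasVal.

Section FractionEval.
Variables (A : idomainType) (K : fieldType) (w : {rmorphism A -> K}).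
Local Notation F := {fraction A}.
Local Notation "p %:F" := (@tofrac A p).

(* This depends on the chosen representative of f unless w is injective, in
   which case it is a field homomorphism: see [fraceval_rmorphism]. *)
Definition fraceval (f : F) : K := w (\n_(repr f)) / w (\d_(repr f)).

Lemma fracE (f : F) : f = (\n_(repr f))%:F / (\d_(repr f))%:F.
Proof.
have d0 : (\d_(repr f))%:F != 0 by rewrite tofrac_eq0 denom_ratioP.
apply: (mulIf d0); rewrite divfK //.
rewrite -[X in X * _ = _](reprK f).
move: (repr f) => r {d0 f}.
have dr := denom_ratioP r.
rewrite /FracField.tofrac; unlock.
rewrite -[LHS]FracField.pi_mul /FracField.mulf.
rewrite !numden_Ratio ?oner_neq0 // mulr1; apply/eqmodP => /=.
by rewrite FracField.equivfE !numden_Ratio ?oner_neq0 // mulr1 mulrC.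
Qed.

Hypothesis w_inj : forall p, w p = 0 -> p = 0.

Lemma w_neq0 p : p != 0 -> w p != 0.
Proof. by apply: contra_neq; apply: w_inj. Qed.

Lemma fracevalE p q : q != 0 -> fraceval (p%:F / q%:F) = w p / w q.
Proof.
move=> q0; rewrite /fraceval; set f := p%:F / q%:F.
have d0 := denom_ratioP (repr f).
apply/eqP; rewrite eqr_div ?w_neq0 //.
rewrite -!(rmorphM w); apply/eqP; congr (w _).
apply/eqP; rewrite -tofrac_eq !tofracM -eqr_div ?tofrac_eq0 //.
by rewrite -fracE.
Qed.

Lemma fraceval_tofrac p : fraceval p%:F = w p.
Proof. by rewrite -[p%:F]divr1 -tofrac1 fracevalE ?oner_neq0 // rmorph1 divr1. Qed.

Lemma fraceval_rmorphism : zmod_morphism fraceval /\ monoid_morphism fraceval.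
Proof.
split; last split.
- move=> f g; rewrite [f]fracE [g]fracE.
  move: (denom_ratioP (repr f)) (denom_ratioP (repr g)).
  move: (\n_(repr f)) (\n_(repr g)) (\d_(repr f)) (\d_(repr g)) => a c b d b0 d0.
  rewrite -mulNr addf_div ?tofrac_eq0 // -tofracN -!tofracM -tofracD.
  rewrite !fracevalE ?mulf_neq0 // rmorphD !rmorphM rmorphN.
  by rewrite -mulNr addf_div ?w_neq0.
- by rewrite -tofrac1 fraceval_tofrac rmorph1.
- move=> f g; rewrite [f]fracE [g]fracE.
  move: (denom_ratioP (repr f)) (denom_ratioP (repr g)).
  move: (\n_(repr f)) (\n_(repr g)) (\d_(repr f)) (\d_(repr g)) => a c b d b0 d0.
  rewrite mulf_div -!tofracM.
  by rewrite !fracevalE ?mulf_neq0 // !rmorphM mulf_div.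
Qed.

Lemma fraceval_unique (g : {rmorphism F -> K}) :
  (forall p, g p%:F = w p) -> g =1 fraceval.
Proof. by move=> gp f; rewrite [f in LHS]fracE fmorph_div !gp. Qed.

End FractionEval.

Section Substitution.
Variables (N : nat) (K : fieldType) (c : {rmorphism rat -> K}).
Local Notation A := {mpoly rat[N]}.
Local Notation F := {fraction A}.

Definition constF : {rmorphism rat -> F} := (@tofrac A \o @mpolyC N rat)%FUN.

Definition polysubst (v : 'I_N -> K) : {rmorphism A -> K} := mmap c v.

Lemma polysubstXU v k : polysubst v 'X_k = v k.
Proof. by rewrite [LHS]mmapX mmap1U. Qed.

Lemma polysubstC v a : polysubst v a%:MP = c a.
Proof. by rewrite [LHS]mmapC. Qed.

End Substitution.

Section SubstitutionTheory.
Variables (N : nat).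
Local Notation A := {mpoly rat[N]}.
Local Notation F := {fraction A}.
Local Notation hasval := (@hasval A F _ (@tofrac A)).

Lemma hasval_polysubst (K : fieldType) (w : {rmorphism A -> K}) (c : {rmorphism rat -> K})
    (v : 'I_N -> F) (u : 'I_N -> K) p :
  (forall a, w a%:MP = c a) ->
  (forall k, hasval w (v k) (u k)) ->
  hasval w (polysubst (constF N) v p) (polysubst c u p).
Proof.
move=> wc H; rewrite /polysubst /= /mmap; apply: hasval_sum => mm _.
apply: hasvalM; first by rewrite -wc; apply: hasval_embed.
by apply: hasval_prod => i _; apply: hasvalXn.
Qed.

Lemma polysubst_id p : polysubst (constF N) (fun k => tofrac 'X_k) p = tofrac p.
Proof.
rewrite [in RHS](mpolyE p) rmorph_sum /polysubst /= /mmap; apply: eq_bigr => mm _.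
rewrite -mul_mpolyC rmorphM mpolyXE_id rmorph_prod; congr (_ * _).
by apply: eq_bigr => i _; rewrite rmorphXn.
Qed.

Lemma tofrac_injective : injective (@tofrac A).
Proof. by move=> p q /eqP; rewrite tofrac_eq => /eqP. Qed.

Lemma polysubst_inj (v w : 'I_N -> F) :
  (forall k, hasval (polysubst (constF N) w) (v k) (tofrac 'X_k)) ->
  forall p, polysubst (constF N) v p = 0 -> p = 0.
Proof.
move=> H p p0.
have := hasval_polysubst p (polysubstC (constF N) w) H.
rewrite p0 polysubst_id => /(hasval0_eq0 tofrac_injective)/eqP.
by rewrite tofrac_eq0 => /eqP.
Qed.

Lemma polysubst_unique (g : {rmorphism A -> F}) v :
  (forall k, g 'X_k = v k) -> g =1 polysubst (constF N) v.
Proof.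
move=> gX p; rewrite [in LHS](mpolyE p) rmorph_sum; apply: eq_bigr => mm _.
rewrite -mul_mpolyC rmorphM mpolyXE_id rmorph_prod; congr (_ * _).
  have E := fmorph_eq_rat (g \o @mpolyC N rat)%FUN.
  by rewrite [LHS]E (fmorph_eq_rat (constF N)).
by apply: eq_bigr => i _; rewrite rmorphXn gX.
Qed.

End SubstitutionTheory.

Section RowIdentities.
Variables (n : nat) (K : fieldType) (a b y : 'Z_n -> K).
Hypothesis y_neq0 : forall i, y i != 0.

Definition rowscale (y : 'Z_n -> K) : K :=
  \sum_l a (l + 1) * b l / (y l * y (l + 1)).

Lemma Zp_succ_neq (l : 'Z_n) : l + 1 != l.
Proof. by rewrite -subr_eq0 addrC addKr oner_neq0. Qed.

Lemma rowscaleE i :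
  (\sum_l a (l + 1) * (\prod_(h | (h != l) && (h != l + 1)) y h) * b l)
    / \prod_(h | h != i) y h = y i * rowscale y.
Proof.
have P0 : \prod_(h | h != i) y h != 0 by apply/prodf_neq0.
apply: (mulIf P0); rewrite divfK // mulrAC.
have <- : \prod_h y h = y i * \prod_(h | h != i) y h by rewrite (bigD1 i).
rewrite /rowscale mulr_sumr; apply: eq_bigr => l _.
rewrite [\prod_h y h](bigD1 l) //= [\prod_(h | h != l) y h](bigD1 (l + 1)) ?Zp_succ_neq //=.
set Y := \prod_(h | _) _.
have := y_neq0 l; have := y_neq0 (l + 1).
move: (y l) (y (l + 1)) => u v u0 v0.
by field; rewrite u0 v0.
Qed.

Lemma rowscaleV (T := rowscale y) :
  T != 0 -> T^-1 = rowscale (fun l => y l * T).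
Proof.
move=> T0; apply: (mulIf (mulf_neq0 T0 T0)); rewrite mulKf //.
rewrite {1}/T /rowscale mulr_suml; apply: eq_bigr => l _.
have := y_neq0 l; have := y_neq0 (l + 1).
move: (y l) (y (l + 1)) => u v u0 v0.
by field; rewrite u0 v0 T0.
Qed.
End RowIdentities.

Lemma hasval_rowscale n (A : comNzRingType) (F K : fieldType)
    (iota : {rmorphism A -> F}) (w : {rmorphism A -> K})
    (a b y : 'Z_n -> F) (a' b' y' : 'Z_n -> K) :
    injective iota -> (forall i, y' i != 0) ->
    (forall i, hasval iota w (a i) (a' i)) ->
    (forall i, hasval iota w (b i) (b' i)) ->
    (forall i, hasval iota w (y i) (y' i)) ->
  hasval iota w (rowscale a b y) (rowscale a' b' y').
Proof.
move=> inj y0 ha hb hy; apply: hasval_sum => l _.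
apply: hasvalM; first exact: hasvalM.
by apply: hasvalV; rewrite ?mulf_neq0 //; apply: hasvalM.
Qed.

(* The variables are indexed by all pairs (j, i) with 0 <= j <= m, i in Z/n.
   'Z_n has n elements only when n >= 2. *)
Definition nvars (m n : nat) : nat := #|{: 'I_m.+1 * 'Z_n}|.

Definition clusterF (m n : nat) : fieldType :=
  {fraction {mpoly rat[nvars m n]}}.

Section ClusterRMatrix.
Variables m n : nat.
Local Notation F := (clusterF m n).
Local Notation N := (nvars m n).

(* Only meaningful for j <= m, as [inord j] is 0 beyond. *)
Definition xvar (j : nat) (i : 'Z_n) : F :=
  tofrac 'X_(enum_rank ((inord j : 'I_m.+1), i)).

Definition RMvalue (j : nat) (i : 'Z_n) : F :=
  (\sum_(l : 'Z_n)
      xvar j.-1 (l + 1) * (\prod_(h | (h != l) && (h != l + 1)) xvar j h) * xvar j.+1 l)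
  / \prod_(h | h != i) xvar j h.

Definition RMpoint (j : nat) (k : 'I_N) : F :=
  let: (j', i) := enum_val k in
  if j' == j :> nat then RMvalue j i else xvar j' i.

(* For 1 <= j <= m - 1 this is the unique field endomorphism of F with the
   prescribed values on the variables: see [RM_rmorphism], [RM_fixed],
   [RM_moved] and [RM_unique]. *)
Definition RM (j : nat) : F -> F :=
  fraceval (polysubst (constF N) (RMpoint j)).

Lemma x_neq0 j i : xvar j i != 0.
Proof.
by rewrite /xvar tofrac_eq0 -msize_poly_eq0 msizeX.
Qed.

Lemma tofracXE (k : 'I_N) (p := enum_val k : 'I_m.+1 * 'Z_n) :
  tofrac 'X_k = xvar p.1 p.2.
Proof. by rewrite /xvar inord_val -surjective_pairing enum_valK. Qed.

Section Row.
Variable j : nat.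
Hypothesis hj : (0 < j < m)%N.

Let hj_le : (j <= m)%N. Proof. by case/andP: hj => _ /ltnW. Qed.
Let hjp_le : (j.-1 <= m)%N. Proof. exact: leq_trans (leq_pred _) hj_le. Qed.
Let hjp_neq : j.-1 != j.
Proof. by case/andP: hj => j0 _; rewrite neq_ltn prednK // leqnn. Qed.
Let hjs_le : (j.+1 <= m)%N. Proof. by case/andP: hj. Qed.
Let hjs_neq : j.+1 != j. Proof. by rewrite neq_ltn leqnn orbT. Qed.

Definition RMscale : F := rowscale (xvar j.-1) (xvar j.+1) (xvar j).

Lemma RMvalueE i : RMvalue j i = xvar j i * RMscale.
Proof. exact/rowscaleE/x_neq0. Qed.

Lemma RMpointx j' i : (j' <= m)%N ->
  RMpoint j (enum_rank ((inord j' : 'I_m.+1), i))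
  = if j' == j then RMvalue j i else xvar j' i.
Proof. by move=> h; rewrite /RMpoint enum_rankK inordK. Qed.

Lemma RMscale_neq0 : RMscale != 0.
Proof.
pose w := polysubst (@idfun rat) (fun _ : 'I_N => 1).
have X a b : hasval (@tofrac _) w (xvar a b) 1.
  by rewrite -(polysubstXU idfun (fun _ : 'I_N => 1)
       (enum_rank ((inord a : 'I_m.+1), b))); apply: hasval_embed.
have := @hasval_rowscale n _ _ _ (@tofrac _) w _ _ _ (fun=> 1) (fun=> 1) (fun=> 1)
  (@tofrac_injective _) (fun=> oner_neq0 _) (X j.-1) (X j.+1) (X j).
rewrite -/RMscale => H; apply/negP => /eqP E; move: H; rewrite E.
move=> /(hasval0_eq0 (@tofrac_injective _))/eqP.
rewrite /rowscale /= (eq_bigr (fun=> 1)) => [|l _]; last by rewrite !mulr1.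
rewrite sumr_const.
by rewrite Num.Theory.pnatr_eq0 card_ord.
Qed.

Local Notation hv := (hasval (@tofrac _) (polysubst (constF N) (RMpoint j))).

Let hvx j' i : (j' <= m)%N -> hv (xvar j' i) (if j' == j then RMvalue j i else xvar j' i).
Proof.
move=> h; rewrite -RMpointx // -(polysubstXU (constF N) (RMpoint j)).
exact: hasval_embed.
Qed.

Let hvx_neq j' i : (j' <= m)%N -> j' != j -> hv (xvar j' i) (xvar j' i).
Proof. by move=> h /negbTE nj; have := hvx i h; rewrite nj. Qed.

Let hvx_eq i : hv (xvar j i) (xvar j i * RMscale).
Proof. by have := hvx i hj_le; rewrite eqxx RMvalueE. Qed.

Let hv_scale : hv RMscale RMscale^-1.
Proof.
rewrite (rowscaleV (x_neq0 j) RMscale_neq0).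
apply: hasval_rowscale => [|i|i|i|i].
- exact: tofrac_injective.
- by rewrite mulf_neq0 ?x_neq0 ?RMscale_neq0.
- exact: hvx_neq.
- exact: hvx_neq.
- exact: hvx_eq.
Qed.

Lemma RMpoint_inverse k : hv (RMpoint j k) (tofrac 'X_k).
Proof.
rewrite tofracXE /RMpoint; case: (enum_val k) => j' i /=.
case: eqP => [->|/eqP nj]; last by apply: hvx_neq; rewrite // -ltnS.
rewrite RMvalueE -[X in hv _ X](mulfK RMscale_neq0).
exact: hasvalM.
Qed.

Let RMpoint_free : forall p, polysubst (constF N) (RMpoint j) p = 0 -> p = 0.
Proof. exact: polysubst_inj RMpoint_inverse. Qed.

Lemma RM_rmorphism : zmod_morphism (RM j) /\ monoid_morphism (RM j).
Proof. exact: fraceval_rmorphism RMpoint_free. Qed.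

Lemma RM_x j' i : (j' <= m)%N ->
  RM j (xvar j' i) = if j' == j then RMvalue j i else xvar j' i.
Proof.
move=> h; rewrite -RMpointx // -(polysubstXU (constF N) (RMpoint j)).
exact: fraceval_tofrac RMpoint_free _.
Qed.

Lemma RM_fixed j' i : (j' <= m)%N -> j' != j -> RM j (xvar j' i) = xvar j' i.
Proof. by move=> h /negbTE nj; rewrite RM_x // nj. Qed.

Lemma RM_moved i : RM j (xvar j i) = RMvalue j i.
Proof. by rewrite RM_x // eqxx. Qed.

Lemma RM_unique (g : {rmorphism F -> F}) :
  (forall j' i, (j' <= m)%N -> j' != j -> g (xvar j' i) = xvar j' i) ->
  (forall i, g (xvar j i) = RMvalue j i) ->
  g =1 RM j.
Proof.
move=> g1 g2; apply: fraceval_unique.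
apply: (polysubst_unique (g := (g \o @tofrac _)%FUN)) => k /=.
rewrite tofracXE /RMpoint; case: (enum_val k) => j' i /=.
by case: eqP => [->|/eqP nj]; [apply: g2 | apply: g1; rewrite // -ltnS].
Qed.

End Row.
End ClusterRMatrix.

Arguments xvar : clear implicits.
Arguments RM : clear implicits.

(* Main.v *)
From HB Require Import structures.
Require Import Defs.
From mathcomp Require Import all_boot all_order all_algebra all_fingroup.
From mathcomp.multinomials Require Import mpoly.
From mathcomp Require Import ring zify.

Set Implicit Arguments.
Unset Strict Implicit.
Unset Printing Implicit Defensive.

Import GRing.Theory.
Local Open Scope ring_scope.

(** Write T_j for [RMscale m n j], so that R_{M_j} multiplies every x_{j,i} by
    T_j and fixes the other variables.  Rescaling the rows of variables by
    factors r_j independent of i multiplies T_j by r_{j-1} r_{j+1} / r_j^2, so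
    the T_j transform like exponentials of the simple roots of type A_{m-1}
    and the x_{j,i} like exponentials of fundamental weights.

    This suggests writing T_j = u_j / u_{j-1} with u_a = T_1 ... T_a (the
    [potential], 0 <= a < m) and letting every permutation s of {0, ..., m-1}
    act at once, by the substitution
      x_{j,i}  |->  x_{j,i} * \prod_(a < j) u_{s a} / u_a.
    The rescaling rule makes the prefix products collapse: the substitution
    sends T_b to u_{s b} / u_{s (b-1)}, hence u_c / u_a to u_{s c} / u_{s a}
    ([hasval_potential_ratio]).  Therefore the substitutions compose like the
    permutations ([hasval_permpoint]).  Composing with the one of s^-1 shows
    that each is injective on polynomials, so that it extends to the fraction
    field, and an action of the whole symmetric group results.

    For the transposition of j-1 and j, the prefix {a < k} is stable unless
    k = j, and the factor of row j is u_j / u_{j-1} = T_j: this transposition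
    acts as R_{M_j} ([RM_tperm]).  All the relations between the R_{M_j} are
    thus identities between transpositions. *)

(** * Values of fractions and row scales *)

(** Values in the sense of [hasval] are the values of any field morphism that
    extends the evaluation of polynomials; this transfers the computations
    with fractions made before that morphism is known to exist. *)
Lemma hasval_rmorph (A : comNzRingType) (F K : fieldType)
    (iota : {rmorphism A -> F}) (w : {rmorphism A -> K}) (g : F -> K) f v :
  zmod_morphism g /\ monoid_morphism g -> (forall p, g (iota p) = w p) ->
  hasval iota w f v -> g f = v.
Proof.
move=> [_ [_ gM]] gw [p [q [q0 ef ev]]].
by apply: (mulIf q0); rewrite ev -!gw -gM ef.
Qed.

Lemma rowscale_rescale n (K : fieldType) (a b y : 'Z_n -> K) (r s t : K) :
  rowscale (fun i => a i * r) (fun i => b i * s) (fun i => y i * t)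
  = rowscale a b y * (r * s / t ^+ 2).
Proof.
rewrite /rowscale mulr_suml; apply: eq_bigr => l _.
by rewrite mulrACA (mulrACA (y l)) -expr2 invfM [LHS]mulrACA.
Qed.

(** The collapse behind [hasval_permscale]: there r is the factor of row a,
    p and q are the permuted potentials of a and b, u and v the original ones,
    and the left factor v / u is T_b. *)
Lemma rescale_cancel (K : fieldType) (r u v p q : K) :
    r != 0 -> u != 0 -> v != 0 -> p != 0 ->
  v / u * (r * (r * (p / u) * (q / v)) / (r * (p / u)) ^+ 2) = q / p.
Proof. by move=> r0 u0 v0 p0; field; rewrite r0 u0 v0 p0. Qed.

(** * The action of the symmetric group by row rescalings *)

Section PermutationAction.
Variables m n : nat.
Local Notation F := (clusterF m n).
Local Notation A := {mpoly rat[nvars m n]}.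

(** The convention makes T_b a ratio of consecutive potentials.  Only ratios of
    potentials transform well: [potential 0] is 1, whereas a permutation that
    moves 0 should send it to another potential. *)
Definition potential (k : nat) : F := \prod_(1 <= l < k.+1) RMscale m n l.

Lemma potential_neq0 k : potential k != 0.
Proof. by rewrite prodf_seq_neq0; apply/allP => l _; apply: RMscale_neq0. Qed.

Lemma potentialS k : potential k.+1 = potential k * RMscale m n k.+1.
Proof. by rewrite /potential big_nat_recr. Qed.

Section OnePermutation.
Variable s : {perm 'I_m}.

Definition rowfactor (j : nat) : F :=
  \prod_(a < m | (a < j)%N) (potential (s a) / potential a).

Lemma rowfactor_neq0 j : rowfactor j != 0.
Proof.
by apply/prodf_neq0 => a _; rewrite mulf_neq0 ?invr_eq0 ?potential_neq0.
Qed.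

Lemma rowfactorS (a : 'I_m) :
  rowfactor a.+1 = rowfactor a * (potential (s a) / potential a).
Proof.
rewrite /rowfactor (bigD1 a) //= mulrC; congr (_ * _).
by apply: eq_bigl => c; rewrite ltnS ltn_neqAle andbC.
Qed.

Definition permpoint (k : 'I_(nvars m n)) : F :=
  let: (j, i) := enum_val k in xvar m n j i * rowfactor j.

Local Notation permpoly := (polysubst (constF (nvars m n)) permpoint).
Local Notation hv := (hasval (@tofrac A) permpoly).

Definition permmor : F -> F := fraceval permpoly.

Lemma hasval_permx j i : (j <= m)%N ->
  hv (xvar m n j i) (xvar m n j i * rowfactor j).
Proof.
move=> le_jm; have -> : xvar m n j i * rowfactor j
    = permpoly 'X_(enum_rank ((inord j : 'I_m.+1), i)).
  by rewrite polysubstXU /permpoint enum_rankK inordK.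
exact: hasval_embed.
Qed.

(** The rows a, b and b+1 are scaled by prefix products that differ by one
    factor each time, so that the second-difference quotient by which T_b is
    multiplied involves the indices a and b alone. *)
Lemma hasval_permscale (a b : 'I_m) : b = a.+1 :> nat ->
  hv (RMscale m n b) (potential (s b) / potential (s a)).
Proof.
move=> def_b; have le_bm := ltn_ord b.
have -> : potential (s b) / potential (s a)
    = rowscale (fun i => xvar m n a i * rowfactor a)
               (fun i => xvar m n b.+1 i * rowfactor b.+1)
               (fun i => xvar m n b i * rowfactor b).
  rewrite rowscale_rescale rowfactorS def_b rowfactorS -def_b.
  have -> : rowscale (xvar m n a) (xvar m n b.+1) (xvar m n b)
            = potential b / potential a.
    by rewrite def_b potentialS mulrAC divff ?potential_neq0 // mul1r
      /RMscale.
  rewrite rescale_cancel ?potential_neq0 ?rowfactor_neq0 //.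
rewrite /RMscale {1}def_b /=; apply: hasval_rowscale => [|i|i|i|i].
- exact: tofrac_injective.
- by rewrite mulf_neq0 ?x_neq0 ?rowfactor_neq0.
- by apply: hasval_permx; apply: ltnW.
- exact: hasval_permx.
- by apply: hasval_permx; apply: ltnW.
Qed.

(** By telescoping, from the ratios of consecutive potentials. *)
Lemma hasval_potential_ratio (a c : 'I_m) :
  hv (potential c / potential a) (potential (s c) / potential (s a)).
Proof.
pose o := Ordinal (leq_ltn_trans (leq0n a) (ltn_ord a)).
have so0 := potential_neq0 (s o).
have hU : forall b : 'I_m, hv (potential b) (potential (s b) / potential (s o)).
  case=> k; elim: k => [|k IHk] lt_k.
    rewrite (_ : Ordinal lt_k = o); last exact: val_inj.
    by rewrite divff // /potential big_geq //; apply: hasval1.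
  have lt_k' := ltnW lt_k; pose b := Ordinal lt_k'.
  rewrite /= potentialS.
  rewrite -[X in hv _ X](_ : potential (s b) / potential (s o) *
    (potential (s (Ordinal lt_k)) / potential (s b)) = _); last first.
    by rewrite mulrC mulrA divfK ?potential_neq0.
  exact: hasvalM (IHk lt_k') (@hasval_permscale b (Ordinal lt_k) erefl).
have -> : potential (s c) / potential (s a)
    = (potential (s c) / potential (s o)) / (potential (s a) / potential (s o)).
  by rewrite invf_div mulrA divfK.
have ua0 : potential (s a) / potential (s o) != 0.
  by rewrite mulf_neq0 ?invr_eq0 ?potential_neq0.
exact: hasvalM (hU c) (hasvalV (@tofrac_injective _) ua0 (hU a)).
Qed.

End OnePermutation.

Lemma permpoint1 k : permpoint 1 k = tofrac 'X_k.
Proof.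
rewrite tofracXE /permpoint; case: (enum_val k) => j i /=.
rewrite /rowfactor big1 ?mulr1 // => a _.
by rewrite perm1 divff ?potential_neq0.
Qed.

(** The composition law, stated with [hasval] because it is what proves that
    the substitutions extend to fractions.  The product is [t * s] since
    substituting s into the image of t replaces u_{t a} by u_{s (t a)}, and
    permutations are multiplied from left to right. *)
Lemma hasval_permpoint (s t : {perm 'I_m}) k :
  hasval (@tofrac A) (polysubst (constF (nvars m n)) (permpoint s))
    (permpoint t k) (permpoint (t * s)%g k).
Proof.
rewrite /permpoint; case: (enum_val k) => j i.
have -> : rowfactor (t * s)%g j = rowfactor s j *
    \prod_(a < m | (a < j)%N) (potential (s (t a)) / potential (s a)).
  rewrite -big_split; apply: eq_bigr => a _ /=.
  by rewrite permM [RHS]mulrC mulrA divfK ?potential_neq0.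
rewrite mulrA; apply: hasvalM; first by apply: hasval_permx; rewrite -ltnS.
by apply: hasval_prod => a _; apply: hasval_potential_ratio.
Qed.

(** The substitution attached to s^-1 is a left inverse. *)
Lemma permpoly_free s p :
  polysubst (constF (nvars m n)) (permpoint s) p = 0 -> p = 0.
Proof.
move: p; apply: (@polysubst_inj _ _ (permpoint s^-1)%g) => k.
by rewrite -permpoint1 -(mulgV s); apply: hasval_permpoint.
Qed.

Lemma permmor_rmorphism s : zmod_morphism (permmor s) /\ monoid_morphism (permmor s).
Proof. exact: fraceval_rmorphism (@permpoly_free s). Qed.

Lemma permmor_tofrac s p :
  permmor s (tofrac p) = polysubst (constF (nvars m n)) (permpoint s) p.
Proof. exact: fraceval_tofrac (@permpoly_free s) p. Qed.

HB.instance Definition _ s :=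
  GRing.isZmodMorphism.Build F F (permmor s) (permmor_rmorphism s).1.
HB.instance Definition _ s :=
  GRing.isMonoidMorphism.Build F F (permmor s) (permmor_rmorphism s).2.

Lemma permmor_unique s (g : {rmorphism F -> F}) :
  (forall k, g (tofrac 'X_k) = permpoint s k) -> g =1 permmor s.
Proof.
move=> gX; apply: fraceval_unique.
exact: (polysubst_unique (g := (g \o @tofrac _)%FUN)).
Qed.

Lemma permmor1 : permmor 1 =1 id.
Proof.
by move=> f; rewrite -(@permmor_unique 1%g idfun) // => k; rewrite permpoint1.
Qed.

Lemma permmorM s t f : permmor (s * t)%g f = permmor t (permmor s f).
Proof.
apply: esym; move: f; apply: (@permmor_unique _ (permmor t \o permmor s)%FUN) => k /=.
rewrite [permmor s _]permmor_tofrac polysubstXU.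
apply: hasval_rmorph (permmor_rmorphism t) (permmor_tofrac t) _.
exact: hasval_permpoint.
Qed.

Definition perm_act : {action {perm 'I_m} &-> F} :=
  TotalAction (to := fun f s => permmor s f) permmor1
    (fun f s t => permmorM s t f).

(** The product of the potentials over {c < j} is invariant under a permutation
    that preserves this set, and the transposition of a and a+1 preserves it
    unless j = a+1. *)
Lemma rowfactor_tperm (a b : 'I_m) j : b = a.+1 :> nat ->
  rowfactor (tperm a b) j = if j == b then RMscale m n b else 1.
Proof.
move=> def_b.
have off (k : nat) : k != b -> rowfactor (tperm a b) k = 1.
  move=> neq_kb; rewrite /rowfactor prodf_div.
  rewrite [X in X / _](reindex_inj (@perm_inj _ (tperm a b))) /=.
  rewrite [X in X / _](_ : _ = \prod_(c < m | (c < k)%N) potential c).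
    by rewrite divff //; apply/prodf_neq0 => c _; apply: potential_neq0.
  apply: eq_big => [c|c _]; last by rewrite tpermK.
  by case: tpermP => // ->; lia.
case: eqP => [->|/eqP]; last exact: off.
rewrite {1}def_b rowfactorS off; last lia.
by rewrite tpermL mul1r def_b potentialS mulrAC divff ?potential_neq0 ?mul1r.
Qed.

Lemma RM_tperm (a b : 'I_m) : b = a.+1 :> nat ->
  RM m n b =1 permmor (tperm a b).
Proof.
move=> def_b; have hb : (0 < b < m)%N by rewrite ltn_ord def_b.
pose g1 := GRing.isZmodMorphism.Build F F (RM m n b) (RM_rmorphism n hb).1.
pose g2 := GRing.isMonoidMorphism.Build F F (RM m n b) (RM_rmorphism n hb).2.
pose g : {rmorphism F -> F} := HB.pack (RM m n b) g1 g2.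
apply: (@permmor_unique _ g) => k.
change (RM m n b (tofrac 'X_k) = permpoint (tperm a b) k).
rewrite tofracXE /permpoint; case: (enum_val k) => j i.
rewrite (RM_x hb i (ltn_ord j : (j <= m)%N)) (rowfactor_tperm j def_b).
by case: eqP => [->|_]; [exact: RMvalueE | rewrite mulr1].
Qed.

End PermutationAction.

(** * Relations between transpositions *)

(** Both sides are conjugates equal to the transposition of a and c. *)
Lemma tperm_braid (T : finType) (a b c : T) : a != b -> b != c -> a != c ->
  (tperm a b * tperm b c * tperm a b = tperm b c * tperm a b * tperm b c)%g.
Proof.
move=> ab bc ac.
have -> : (tperm a b * tperm b c * tperm a b = tperm a c)%g.
  rewrite -{1}(tpermV a b) -mulgA -[LHS]/(_ ^ _)%g tpermJ tpermR.
  by rewrite tpermD.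
rewrite -{1}(tpermV b c) -mulgA -[RHS]/(_ ^ _)%g tpermJ tpermL.
by rewrite tpermD // eq_sym.
Qed.

Lemma tperm_disjoint_comm (T : finType) (a b c d : T) :
    a != c -> a != d -> b != c -> b != d ->
  (tperm a b * tperm c d = tperm c d * tperm a b)%g.
Proof. by move=> *; rewrite conjgC tpermJ !tpermD // eq_sym. Qed.

(** * The relations between simple cluster R-matrices *)

Theorem theorem3p2 (n m : nat) (hn : (2 <= n)%N) (hm : (2 <= m)%N) :
  [/\ forall i : nat, (1 <= i <= m - 2)%N ->
        RM m n i \o RM m n i.+1 \o RM m n i
        =1 RM m n i.+1 \o RM m n i \o RM m n i.+1,
      forall i : nat, (1 <= i <= m - 1)%N -> RM m n i \o RM m n i =1 id,
      forall i j : nat, (1 <= i <= m - 1)%N -> (1 <= j <= m - 1)%N ->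
        1 < `|i%:Z - j%:Z| ->
        RM m n i \o RM m n j =1 RM m n j \o RM m n i
    & exists act : {action {perm 'I_m} &-> clusterF m n},
        (forall s : {perm 'I_m},
           zmod_morphism (act^~ s) /\ monoid_morphism (act^~ s)) /\
        (forall a b : 'I_m, b = a.+1 :> nat ->
           act^~ (tperm a b) =1 RM m n b)].
Proof.
have ordRM i : (1 <= i <= m - 1)%N ->
    exists a b : 'I_m, [/\ a = i.-1 :> nat, b = i :> nat &
                           RM m n i =1 permmor (tperm a b)].
  move=> hi; have lt_im : (i < m)%N by lia.
  have lt_jm : (i.-1 < m)%N by lia.
  have succ_j : Ordinal lt_im = (Ordinal lt_jm).+1 :> nat by rewrite /=; lia.
  exists (Ordinal lt_jm), (Ordinal lt_im).
  split; [by [] | by [] | exact: (RM_tperm succ_j)].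
split.
- move=> i hi f.
  have [|a [b [ea eb Ei]]] := ordRM i; first lia.
  have [|b' [c [eb' ec Ej]]] := ordRM i.+1; first lia.
  have b'_b : b' = b by apply: val_inj; rewrite /= eb' eb.
  rewrite b'_b in Ej.
  change (RM m n i (RM m n i.+1 (RM m n i f))
    = RM m n i.+1 (RM m n i (RM m n i.+1 f))).
  rewrite !Ei !Ej -!permmorM !mulgA tperm_braid //;
    by apply/eqP => /(congr1 val) /=; lia.
- move=> i /ordRM[a [b [_ _ E]]] f.
  change (RM m n i (RM m n i f) = f).
  by rewrite !E -permmorM tperm2 permmor1.
- move=> i j hi hj far f.
  have [a [b [ea eb Ei]]] := ordRM i hi; have [c [d [ec ed Ej]]] := ordRM j hj.
  change (RM m n i (RM m n j f) = RM m n j (RM m n i f)).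
  rewrite !Ei !Ej -!permmorM tperm_disjoint_comm //;
    by apply/eqP => /(congr1 val) /=; lia.
- exists (perm_act m n); split=> [s|a b def_b f]; first exact: permmor_rmorphism.
  exact: esym (RM_tperm def_b f).
Qed.
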